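(* Let $D,T,L_0>0$, let $L>0$ and $A$ be real-valued $T$-periodic functions on $\mathbb{R}$ of class $C^{2+\alpha}$ for some $\alpha>0$, and let $\mu$ be the principal periodic eigenvalue of the operator $$u\mapsto\frac{\partial u}{\partial t}-D\frac{L_0^2}{L(t)^2}\frac{\partial^2u}{\partial\xi^2}-\left(\frac{\dot A(t)L_0+\xi\dot L(t)}{L(t)}\right)\frac{\partial u}{\partial\xi}\qquad\text{on }0<\xi<L_0$$ with zero Dirichlet conditions at $\xi=0$ and $\xi=L_0$. Define $$\overline Q(t)=\max_{0\le\eta\le1}\left(\frac{\eta^2\ddot L(t)L(t)}{2}+\eta\ddot A(t)L(t)\right),\qquad \underline Q(t)=-\min_{0\le\eta\le1}\left(\frac{\eta^2\ddot L(t)L(t)}{2}+\eta\ddot A(t)L(t)\right).$$ Then $$\frac1T\int_0^T\left(\frac{D\pi^2}{L(t)^2}+\frac{\dot A(t)^2}{4D}-\frac{\overline Q(t)}{2D}\right)dt\ \le\ \mu\ \le\ \frac1T\int_0^T\left(\frac{D\pi^2}{L(t)^2}+\frac{\dot A(t)^2}{4D}+\frac{\underline Q(t)}{2D}\right)dt .$$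
   Context: Dots denote derivatives in $t$. The principal periodic eigenvalue of a $T$-periodic parabolic operator $\mathcal{P}$ on $(0,L_0)$ with zero Dirichlet conditions is the unique real number $\mu$ for which there is a function $\phi(\xi,t)$ (unique up to scaling) with $\mathcal{P}\phi=\mu\phi$ for $0<\xi<L_0$, $t\in\mathbb{R}$; $\phi=0$ at $\xi=0$ and $\xi=L_0$; $\phi>0$ for $0<\xi<L_0$; and $\phi(\xi,t)\equiv\phi(\xi,t+T)$. (Existence and uniqueness are known, by Castro and Lazer.) The operator in the claim is the one obtained from $\partial_t-D\,\partial_x^2$ on the time-periodic interval $A(t)<x<A(t)+L(t)$ by the change of variables $\xi=\frac{x-A(t)}{L(t)}L_0$, so $\mu$ is the principal periodic eigenvalue associated with that interval. *)

(* Defs.v *)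
From Stdlib Require Import Reals.
From Coquelicot Require Import Coquelicot.
Open Scope R_scope.

Definition periodic (T : R) (f : R -> R) : Prop :=
  forall t, f (t + T) = f t.

(* Functions of class C^s for a real exponent s = k + beta, with k a natural
   number and 0 <= beta < 1: the k-th derivative is continuous and globally
   beta-Hoelder (for periodic functions, global and local Hoelder continuity
   agree).  When beta = 0 the last clause says that the k-th derivative has
   bounded oscillation, which is automatic for periodic C^k functions.
   Differentiability is required at every order j <= k because [Derive_n] is
   total: [ex_derive_n f k] alone says nothing about the lower orders. *)
Definition of_class (s : R) (f : R -> R) : Prop :=
  exists (k : nat) (beta C : R),
    s = INR k + beta /\ 0 <= beta < 1 /\
    (forall (j : nat) (t : R), (j <= k)%nat -> ex_derive_n f j t) /\
    (forall t, continuous (Derive_n f k) t) /\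
    (forall t1 t2, t1 <> t2 ->
       Rabs (Derive_n f k t1 - Derive_n f k t2)
         <= C * Rpower (Rabs (t1 - t2)) beta).

Definition is_max_on (a b : R) (f : R -> R) (m : R) : Prop :=
  (exists x, a <= x <= b /\ f x = m) /\ (forall x, a <= x <= b -> f x <= m).

Definition is_min_on (a b : R) (f : R -> R) (m : R) : Prop :=
  (exists x, a <= x <= b /\ f x = m) /\ (forall x, a <= x <= b -> m <= f x).

(* Functions of two variables are written u xi t (space first, then time). *)
Definition Dt (u : R -> R -> R) (xi t : R) : R := Derive (fun s => u xi s) t.
Definition Dxi (u : R -> R -> R) (xi t : R) : R := Derive (fun x => u x t) xi.
Definition Dxixi (u : R -> R -> R) : R -> R -> R := Dxi (Dxi u).

(* C^{2,1} on (0,L0) x R and continuous up to the lateral boundary; values of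
   u at xi outside [0,L0] are irrelevant. *)
Definition classical_on_strip (L0 : R) (u : R -> R -> R) : Prop :=
  continuous_on (fun p : R * R => 0 <= fst p <= L0)
    (fun p : R * R => u (fst p) (snd p)) /\
  (forall xi t, 0 < xi < L0 ->
     ex_derive (fun s => u xi s) t /\
     ex_derive (fun x => u x t) xi /\
     ex_derive (fun x => Dxi u x t) xi /\
     continuous (fun p : R * R => Dt u (fst p) (snd p)) (xi, t) /\
     continuous (fun p : R * R => Dxi u (fst p) (snd p)) (xi, t) /\
     continuous (fun p : R * R => Dxixi u (fst p) (snd p)) (xi, t)).

(* By Castro and Lazer, for the T-periodic parabolic operators considered here
   exactly one real mu satisfies this predicate. *)
Definition is_principal_periodic_eigenvalue (L0 T : R)
    (P : (R -> R -> R) -> R -> R -> R) (mu : R) : Prop :=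
  exists phi : R -> R -> R,
    classical_on_strip L0 phi /\
    (forall xi t, 0 < xi < L0 -> P phi xi t = mu * phi xi t) /\
    (forall t, phi 0 t = 0 /\ phi L0 t = 0) /\
    (forall xi t, 0 < xi < L0 -> 0 < phi xi t) /\
    (forall xi t, 0 <= xi <= L0 -> phi xi t = phi xi (t + T)).

(* d/dt - D d^2/dx^2 on A(t) < x < A(t) + L(t), in the variable
   xi = (x - A(t)) / L(t) * L0. *)
Definition interval_operator (D L0 : R) (A L : R -> R)
    (u : R -> R -> R) (xi t : R) : R :=
  Dt u xi t
  - D * (L0 ^ 2 / L t ^ 2) * Dxixi u xi t
  - (Derive A t * L0 + xi * Derive L t) / L t * Dxi u xi t.

Definition Qfun (A L : R -> R) (t eta : R) : R :=
  eta ^ 2 * Derive_n L 2 t * L t / 2 + eta * Derive_n A 2 t * L t.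

(* Main.v *)
Require Import Defs.
From Stdlib Require Import Reals Lra Lia.
From Coquelicot Require Import Coquelicot.
Open Scope R_scope.

(** Write [eta = xi / L0] and let [phi] be the positive periodic eigenfunction.
    The first-order term of the operator is a gradient in [xi], so it can be
    removed by a multiplier: [w = phi * exp G] with
      [G = A' L eta / (2 D) + L L' eta^2 / (4 D) + ln L / 2]
    is again positive, [T]-periodic and zero at both ends, and it satisfies
      [w_t = kap w_xixi + (mu - A'^2 / (4 D) + Q(t, eta) / (2 D)) w],
      [kap = D L0^2 / L^2],
    where [Q] is exactly the quadratic in [eta] whose maximum and minimum enter
    the claim ([gauged_equation]).  The summand [ln L / 2] of [G] absorbs the
    remaining term [L' / (2 L)]; being periodic, it costs nothing.

    The potential now lies between two functions of [t] alone.  For a positive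
    periodic [w] with [w_t <= hi(t) w + kap(t) w_xixi], the moment
    [I = int w sin(PI xi / L0)] formally satisfies
    [I' / I <= hi - kap (PI / L0)^2], and integrating [(ln I)'] over a period
    gives [(PI / L0)^2 int kap <= int hi].  The opposite inequality follows in the
    same way from a lower bound on [w_t].  As [kap (PI / L0)^2 = D PI^2 / L^2],
    these are the two claimed bounds.

    Nothing is known about the derivatives of [w] up to the lateral boundary, so
    the sine is fitted to the interval [e <= xi <= L0 - e] instead.  The
    integration by parts then leaves the boundary term
    [kap k (w(e,t) + w(L0 - e,t))], with [k = PI / (L0 - 2 e)].  It is
    nonnegative, which is all that the bound from below requires
    ([supersolution_bound]); for the bound from above ([subsolution_bound]) it is
    made small by the uniform decay of [w] at the boundary ([lateral_decay]) and
    compared with [I] through the integral of [w] over the middle third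
    ([sine_moment_lower_bound]). *)

(** * Continuity and integration *)

Lemma continuous_2d_snd (f : R -> R) (x t : R) :
  continuous f t -> continuity_2d_pt (fun _ v => f v) x t.
Proof.
  intros Hf.
  apply (continuity_1d_2d_pt_comp f (fun _ v => v)).
  - now apply continuity_pt_filterlim.
  - apply continuity_2d_pt_id2.
Qed.

Lemma continuity_2d_slice (f : R -> R -> R) (x t : R) :
  continuity_2d_pt f x t -> continuous (fun y => f y t) x.
Proof.
  intros Hf. apply continuity_2d_pt_filterlim in Hf.
  refine (continuous_comp_2 (fun y : R => y) (fun _ : R => t) f x _ _ _).
  - apply continuous_id.
  - apply continuous_const.
  - exact Hf.
Qed.

Lemma continuity_2d_swap (f : R -> R -> R) (x t : R) :
  continuity_2d_pt f x t -> continuity_2d_pt (fun u v => f v u) t x.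
Proof.
  intros Hf eps. destruct (Hf eps) as [d Hd].
  exists d. intros u v Hu Hv. now apply Hd.
Qed.

Lemma ex_RInt_cont (f : R -> R) (a b : R) :
  a <= b -> (forall x, a <= x <= b -> continuous f x) -> ex_RInt f a b.
Proof.
  intros Hab Hf. apply (ex_RInt_continuous (V := R_CompleteNormedModule)).
  now rewrite Rmin_left, Rmax_right by exact Hab.
Qed.

(** The mean value theorem for [int g - ln J]: since [J] takes the same value at
    [0] and [T], its logarithmic derivative has mean zero, and a one-sided bound
    of [J' / J] by [g] on the period turns into the sign of [int g]. *)
Lemma mean_log_derivative (T : R) (J J' g : R -> R) :
  0 < T ->
  (forall t, 0 < J t) ->
  (forall t, is_derive J t (J' t)) ->
  (forall t, continuous g t) ->
  J T = J 0 ->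
  exists c, 0 <= c <= T /\ RInt g 0 T = T * (g c - J' c / J c).
Proof.
  intros HT HJ HJ' Hg Hper.
  set (f := fun t => RInt g 0 t - ln (J t)).
  assert (Hf : forall t, is_derive f t (g t - J' t / J t)).
  { intros t. unfold f.
    apply (is_derive_minus (K := R_AbsRing) (V := R_NormedModule)).
    - apply (is_derive_RInt g (fun x => RInt g 0 x) 0 t); [|apply Hg].
      apply filter_forall. intros x. apply (RInt_correct (V := R_CompleteNormedModule)).
      apply (ex_RInt_continuous (V := R_CompleteNormedModule)). intros; apply Hg.
    - replace (J' t / J t) with (scal (J' t) (/ J t)) by reflexivity.
      apply (is_derive_comp ln J t).
      + apply is_derive_Reals. now apply derivable_pt_lim_ln.
      + apply HJ'. }
  destruct (MVT_gen f 0 T (fun t => g t - J' t / J t)) as [c [Hc E]].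
  - intros x _. apply Hf.
  - intros x _. apply continuity_pt_filterlim.
    apply (ex_derive_continuous (K := R_AbsRing) (V := R_NormedModule)).
    eexists; apply Hf.
  - rewrite Rmin_left, Rmax_right in Hc by lra.
    exists c; split; [exact Hc|].
    unfold f in E. rewrite Hper, RInt_point in E.
    change (@zero R_CompleteNormedModule) with 0 in E. lra.
Qed.

Lemma is_derive_sine (k a x : R) :
  is_derive (fun y => sin (k * (y - a))) x (k * cos (k * (x - a))).
Proof. auto_derive; [exact I|unfold Rminus; ring]. Qed.

Lemma is_derive_cosine (k a x : R) :
  is_derive (fun y => cos (k * (y - a))) x (- k * sin (k * (x - a))).
Proof. auto_derive; [exact I|unfold Rminus; ring]. Qed.

Lemma continuous_of_derive (f : R -> R) (x l : R) :
  is_derive f x l -> continuous f x.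
Proof.
  intros H. apply (ex_derive_continuous (K := R_AbsRing) (V := R_NormedModule)).
  eexists; exact H.
Qed.

(** [sin (k (x - a))] is the first Dirichlet eigenfunction of [a, b]: it kills the
    boundary terms in [f'], and its slopes [k] and [-k] at the two ends leave the
    sum [f a + f b] with a positive sign. *)
Lemma sine_integration_by_parts (a b : R) (f f1 f2 : R -> R) :
  a < b ->
  (forall x, a <= x <= b -> is_derive f x (f1 x)) ->
  (forall x, a <= x <= b -> is_derive f1 x (f2 x)) ->
  (forall x, a <= x <= b -> continuous f2 x) ->
  let k := PI / (b - a) in
  RInt (fun x => f2 x * sin (k * (x - a))) a b
  = k * (f a + f b) - k ^ 2 * RInt (fun x => f x * sin (k * (x - a))) a b.
Proof.
  intros Hab Hf Hf1 Hf2 k.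
  set (s := fun x => sin (k * (x - a))).
  set (c := fun x => cos (k * (x - a))).
  assert (Hs : forall x, continuous s x)
    by (intros x; eapply continuous_of_derive, is_derive_sine).
  assert (Hfc : forall x, a <= x <= b -> continuous f x)
    by (intros x Hx; eapply continuous_of_derive, Hf, Hx).
  assert (ex1 : ex_RInt (fun x => f x * s x) a b).
  { apply ex_RInt_cont; [lra|]. intros x Hx.
    apply (continuous_mult (K := R_AbsRing)); auto. }
  assert (ex2 : ex_RInt (fun x => f2 x * s x) a b).
  { apply ex_RInt_cont; [lra|]. intros x Hx.
    apply (continuous_mult (K := R_AbsRing)); auto. }
  assert (E : is_RInt (fun x => f2 x * s x + k ^ 2 * (f x * s x)) a b
            (f1 b * s b - k * (f b * c b) - (f1 a * s a - k * (f a * c a)))).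
  { apply (is_RInt_derive (V := R_CompleteNormedModule)
             (fun x => f1 x * s x - k * (f x * c x))); intros x Hx;
      rewrite Rmin_left, Rmax_right in Hx by lra.
    - evar_last.
      + apply (is_derive_minus (K := R_AbsRing) (V := R_NormedModule)).
        * apply (is_derive_mult (K := R_AbsRing) f1 s).
          -- apply Hf1, Hx. -- apply is_derive_sine. -- intros; apply Rmult_comm.
        * apply is_derive_scal, (is_derive_mult (K := R_AbsRing) f c).
          -- apply Hf, Hx. -- apply is_derive_cosine. -- intros; apply Rmult_comm.
      + unfold minus, plus, opp, scal, mult; simpl; unfold mult; simpl.
        fold (s x). fold (c x). ring.
    - apply (continuous_plus (V := R_NormedModule)).
      + apply (continuous_mult (K := R_AbsRing)); auto.
      + apply (continuous_scal_r (V := R_NormedModule) (k ^ 2) (fun y => f y * s y)).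
        apply (continuous_mult (K := R_AbsRing)); auto. }
  apply (is_RInt_unique (V := R_CompleteNormedModule)) in E.
  rewrite (RInt_plus (V := R_CompleteNormedModule)
             (fun x => f2 x * s x) (fun x => k ^ 2 * (f x * s x))) in E.
  2: exact ex2.
  2: apply (ex_RInt_scal (V := R_NormedModule)), ex1.
  rewrite (RInt_scal (V := R_CompleteNormedModule) (fun x => f x * s x)) in E by exact ex1.
  unfold plus, scal, mult in E; simpl in E; unfold mult in E; simpl in E.
  assert (Ea : s a = 0 /\ c a = 1).
  { unfold s, c. replace (k * (a - a)) with 0 by ring. now rewrite sin_0, cos_0. }
  assert (Eb : s b = 0 /\ c b = -1).
  { unfold s, c, k. replace (PI / (b - a) * (b - a)) with PI by (field; lra).
    now rewrite sin_PI, cos_PI. }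
  destruct Ea as [Ea1 Ea2], Eb as [Eb1 Eb2].
  rewrite Ea1, Ea2, Eb1, Eb2 in E.
  change (RInt (fun x => f2 x * s x) a b
          = k * (f a + f b) - k ^ 2 * RInt (fun x => f x * s x) a b).
  lra.
Qed.

(** * Sine moments of positive functions *)

(** The derivatives are components of the record, not [Derive], because the function
    to which it is applied is a product whose derivatives are known in closed
    form.  Nothing is required of them at [x = 0] and [x = l]. *)
Record positive_C21 (l : R) (W Wt Wx Wxx : R -> R -> R) : Prop := {
  pc_pos : forall x t, 0 < x < l -> 0 < W x t;
  pc_cont : continuous_on (fun p : R * R => 0 <= fst p <= l)
              (fun p : R * R => W (fst p) (snd p));
  pc_t : forall x t, 0 < x < l -> is_derive (fun s => W x s) t (Wt x t);
  pc_x : forall x t, 0 < x < l -> is_derive (fun y => W y t) x (Wx x t);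
  pc_xx : forall x t, 0 < x < l -> is_derive (fun y => Wx y t) x (Wxx x t);
  pc_t_cont : forall x t, 0 < x < l -> continuity_2d_pt Wt x t;
  pc_xx_cont : forall x t, 0 < x < l -> continuous (fun y => Wxx y t) x
}.

Lemma is_derive_moment (l : R) (W Wt Wx Wxx : R -> R -> R) (psi : R -> R)
  (a b t : R) :
  positive_C21 l W Wt Wx Wxx ->
  0 < a < b -> b < l ->
  (forall x, continuous psi x) ->
  is_derive (fun s => RInt (fun x => W x s * psi x) a b) t
            (RInt (fun x => Wt x t * psi x) a b).
Proof.
  intros HW Ha Hb Hpsi.
  assert (D : forall x s, 0 < x < l ->
     is_derive (fun z => W x z * psi x) s (Wt x s * psi x)).
  { intros x s Hx. evar_last.
    - apply (is_derive_mult (K := R_AbsRing) (fun z => W x z) (fun _ => psi x)).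
      + apply (pc_t _ _ _ _ _ HW x s Hx).
      + apply (is_derive_const (K := R_AbsRing)).
      + intros; apply Rmult_comm.
    - unfold plus, mult, zero; simpl. ring. }
  replace (RInt (fun x => Wt x t * psi x) a b)
    with (RInt (fun x => Derive (fun z => W x z * psi x) t) a b).
  2: { apply RInt_ext. intros x Hx.
       rewrite Rmin_left, Rmax_right in Hx by lra.
       apply is_derive_unique, D. lra. }
  apply (is_derive_RInt_param (fun s x => W x s * psi x)).
  - apply filter_forall. intros s x Hx.
    rewrite Rmin_left, Rmax_right in Hx by lra.
    eexists; apply D; lra.
  - intros x Hx. rewrite Rmin_left, Rmax_right in Hx by lra.
    apply (continuity_2d_pt_ext_loc (fun u v => Wt v u * psi v)).
    + assert (Hd : 0 < Rmin x (l - x)) by (apply Rmin_pos; lra).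
      exists (mkposreal _ Hd). simpl. intros u v _ Hv.
      symmetry. apply is_derive_unique, D.
      apply Rabs_lt_between in Hv.
      pose proof (Rmin_l x (l - x)). pose proof (Rmin_r x (l - x)). lra.
    + apply continuity_2d_pt_mult.
      * apply continuity_2d_swap, (pc_t_cont _ _ _ _ _ HW). lra.
      * now apply continuous_2d_snd.
  - apply filter_forall. intros s. apply ex_RInt_cont; [lra|].
    intros x Hx. apply (continuous_mult (K := R_AbsRing)); [|apply Hpsi].
    eapply continuous_of_derive, (pc_x _ _ _ _ _ HW). lra.
Qed.

Definition sine_moment (W : R -> R -> R) (a b t : R) : R :=
  RInt (fun x => W x t * sin (PI / (b - a) * (x - a))) a b.

Lemma sine_arch_pos (a b x : R) :
  a < x < b -> 0 < sin (PI / (b - a) * (x - a)).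
Proof.
  intros Hx. pose proof PI_RGT_0.
  assert (E : PI / (b - a) * (x - a) = PI * ((x - a) / (b - a))) by (field; lra).
  assert (0 < (x - a) / (b - a)) by (apply Rdiv_lt_0_compat; lra).
  assert ((x - a) / (b - a) < 1).
  { apply (Rmult_lt_reg_r (b - a)); [lra|]. unfold Rdiv.
    rewrite Rmult_assoc, Rinv_l by lra. lra. }
  rewrite E. apply sin_gt_0; nra.
Qed.

(** The condition on [x] places it in the middle two thirds of [a, b], where the
    phase lies between [PI / 6] and [5 PI / 6]. *)
Lemma sine_arch_ge_half (a b x : R) :
  a < b -> 5 * a + b <= 6 * x <= a + 5 * b ->
  / 2 <= sin (PI / (b - a) * (x - a)).
Proof.
  intros Hab Hx. pose proof PI_RGT_0.
  assert (E : PI / (b - a) * (x - a) = PI * ((x - a) / (b - a))) by (field; lra).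
  set (r := (x - a) / (b - a)) in E.
  assert (Hr : r * (b - a) = x - a) by (unfold r; field; lra).
  assert (/ 6 <= r <= 5 / 6) by (split; nra).
  rewrite E, <- Rdiv_1_l, <- sin_PI6.
  destruct (Rle_dec r (/ 2)).
  - apply sin_incr_1; nra.
  - rewrite <- (sin_PI_x (PI * r)). apply sin_incr_1; nra.
Qed.

Lemma continuous_sine_arch (a b x : R) :
  continuous (fun y => sin (PI / (b - a) * (y - a))) x.
Proof. eapply continuous_of_derive, is_derive_sine. Qed.

Lemma continuous_arch_product (f : R -> R) (a b x : R) :
  continuous f x -> continuous (fun y => f y * sin (PI / (b - a) * (y - a))) x.
Proof.
  intros Hf. apply (continuous_mult (K := R_AbsRing)); [exact Hf|].
  apply continuous_sine_arch.
Qed.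

Lemma pc_slice (l : R) (W Wt Wx Wxx : R -> R -> R) (x t : R) :
  positive_C21 l W Wt Wx Wxx -> 0 < x < l -> continuous (fun y => W y t) x.
Proof.
  intros HW Hx. eapply continuous_of_derive, (pc_x _ _ _ _ _ HW), Hx.
Qed.

Lemma sine_moment_pos (l : R) (W Wt Wx Wxx : R -> R -> R) (a b t : R) :
  positive_C21 l W Wt Wx Wxx -> 0 < a < b -> b < l ->
  0 < sine_moment W a b t.
Proof.
  intros HW Ha Hb. apply RInt_gt_0; [lra| |].
  - intros x Hx. apply Rmult_lt_0_compat.
    + apply (pc_pos _ _ _ _ _ HW). lra.
    + now apply sine_arch_pos.
  - intros x Hx. apply (continuous_arch_product (fun y => W y t)).
    apply (pc_slice _ _ _ _ _ _ _ HW). lra.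
Qed.

Lemma is_derive_sine_moment (l : R) (W Wt Wx Wxx : R -> R -> R) (a b t : R) :
  positive_C21 l W Wt Wx Wxx -> 0 < a < b -> b < l ->
  is_derive (sine_moment W a b) t (sine_moment Wt a b t).
Proof.
  intros HW Ha Hb. unfold sine_moment.
  apply (is_derive_moment l W Wt Wx Wxx (fun x => sin (PI / (b - a) * (x - a))));
    try assumption.
  intros x. apply continuous_sine_arch.
Qed.

(** Testing [q W + kap Wxx] against the sine replaces [Wxx] by [- k^2 W], up to
    the two boundary values of [W]. *)
Lemma sine_moment_combination (l kap q : R) (W Wt Wx Wxx : R -> R -> R) (a b t : R) :
  positive_C21 l W Wt Wx Wxx -> 0 < a < b -> b < l ->
  let k := PI / (b - a) in
  RInt (fun x => (q * W x t + kap * Wxx x t) * sin (k * (x - a))) a b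
  = (q - kap * k ^ 2) * sine_moment W a b t + kap * k * (W a t + W b t).
Proof.
  intros HW Ha Hb k.
  assert (E := sine_integration_by_parts a b (fun x => W x t)
                 (fun x => Wx x t) (fun x => Wxx x t)).
  cbv zeta in E. fold k in E.
  assert (ex0 : ex_RInt (fun x => W x t * sin (k * (x - a))) a b).
  { apply ex_RInt_cont; [lra|]. intros x Hx.
    apply (continuous_arch_product (fun y => W y t)), (pc_slice _ _ _ _ _ _ _ HW). lra. }
  assert (ex2 : ex_RInt (fun x => Wxx x t * sin (k * (x - a))) a b).
  { apply ex_RInt_cont; [lra|]. intros x Hx.
    apply (continuous_arch_product (fun y => Wxx y t)), (pc_xx_cont _ _ _ _ _ HW). lra. }
  rewrite (RInt_ext (V := R_CompleteNormedModule) _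
      (fun x => plus (scal q (W x t * sin (k * (x - a))))
                     (scal kap (Wxx x t * sin (k * (x - a)))))).
  2: { intros x _. unfold plus, scal, mult; simpl; unfold mult; simpl. ring. }
  rewrite (RInt_plus (V := R_CompleteNormedModule)).
  2, 3: now apply (ex_RInt_scal (V := R_NormedModule)).
  rewrite !(RInt_scal (V := R_CompleteNormedModule)) by assumption.
  rewrite E.
  - unfold sine_moment. fold k.
    unfold plus, scal, mult; simpl; unfold mult; simpl. ring.
  - lra.
  - intros x Hx. apply (pc_x _ _ _ _ _ HW). lra.
  - intros x Hx. apply (pc_xx _ _ _ _ _ HW). lra.
  - intros x Hx. apply (pc_xx_cont _ _ _ _ _ HW). lra.
Qed.

Lemma sine_moment_mono (f g : R -> R) (a b : R) :
  a < b ->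
  (forall x, a <= x <= b -> continuous f x) ->
  (forall x, a <= x <= b -> continuous g x) ->
  (forall x, a < x < b -> f x <= g x) ->
  RInt (fun x => f x * sin (PI / (b - a) * (x - a))) a b
  <= RInt (fun x => g x * sin (PI / (b - a) * (x - a))) a b.
Proof.
  intros Hab Hf Hg Hle. apply RInt_le; [lra| | |].
  - apply ex_RInt_cont; [lra|]. intros x Hx. apply (continuous_arch_product f), Hf, Hx.
  - apply ex_RInt_cont; [lra|]. intros x Hx. apply (continuous_arch_product g), Hg, Hx.
  - intros x Hx. apply Rmult_le_compat_r; [|now apply Hle].
    now apply Rlt_le, sine_arch_pos.
Qed.

Lemma continuous_rhs_slice (l kap q : R) (W Wt Wx Wxx : R -> R -> R) (x t : R) :
  positive_C21 l W Wt Wx Wxx -> 0 < x < l ->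
  continuous (fun y => q * W y t + kap * Wxx y t) x.
Proof.
  intros HW Hx. apply (continuous_plus (V := R_NormedModule)).
  - apply (continuous_scal_r (V := R_NormedModule) q (fun y => W y t)).
    apply (pc_slice _ _ _ _ _ _ _ HW), Hx.
  - apply (continuous_scal_r (V := R_NormedModule) kap (fun y => Wxx y t)).
    apply (pc_xx_cont _ _ _ _ _ HW), Hx.
Qed.

Lemma continuous_Wt_slice (l : R) (W Wt Wx Wxx : R -> R -> R) (x t : R) :
  positive_C21 l W Wt Wx Wxx -> 0 < x < l -> continuous (fun y => Wt y t) x.
Proof.
  intros HW Hx. apply continuity_2d_slice, (pc_t_cont _ _ _ _ _ HW), Hx.
Qed.

Lemma sine_moment_growth_ge (l kap q : R) (W Wt Wx Wxx : R -> R -> R) (a b t : R) :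
  positive_C21 l W Wt Wx Wxx -> 0 < a < b -> b < l ->
  (forall x, 0 < x < l -> q * W x t + kap * Wxx x t <= Wt x t) ->
  let k := PI / (b - a) in
  (q - kap * k ^ 2) * sine_moment W a b t + kap * k * (W a t + W b t)
  <= sine_moment Wt a b t.
Proof.
  intros HW Ha Hb Hsup k.
  pose proof (sine_moment_combination l kap q W Wt Wx Wxx a b t HW Ha Hb) as E.
  cbv zeta in E. fold k in E. rewrite <- E.
  unfold sine_moment.
  apply (sine_moment_mono (fun x => q * W x t + kap * Wxx x t) (fun x => Wt x t)).
  - lra.
  - intros x Hx. apply (continuous_rhs_slice l kap q W Wt Wx Wxx); [assumption|lra].
  - intros x Hx. apply (continuous_Wt_slice l W Wt Wx Wxx); [assumption|lra].
  - intros x Hx. apply Hsup. lra.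
Qed.

Lemma sine_moment_growth_le (l kap q : R) (W Wt Wx Wxx : R -> R -> R) (a b t : R) :
  positive_C21 l W Wt Wx Wxx -> 0 < a < b -> b < l ->
  (forall x, 0 < x < l -> Wt x t <= q * W x t + kap * Wxx x t) ->
  let k := PI / (b - a) in
  sine_moment Wt a b t
  <= (q - kap * k ^ 2) * sine_moment W a b t + kap * k * (W a t + W b t).
Proof.
  intros HW Ha Hb Hsub k.
  pose proof (sine_moment_combination l kap q W Wt Wx Wxx a b t HW Ha Hb) as E.
  cbv zeta in E. fold k in E. rewrite <- E.
  unfold sine_moment.
  apply (sine_moment_mono (fun x => Wt x t) (fun x => q * W x t + kap * Wxx x t)).
  - lra.
  - intros x Hx. apply (continuous_Wt_slice l W Wt Wx Wxx); [assumption|lra].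
  - intros x Hx. apply (continuous_rhs_slice l kap q W Wt Wx Wxx); [assumption|lra].
  - intros x Hx. apply Hsub. lra.
Qed.

Lemma sine_moment_periodic (l T : R) (W : R -> R -> R) (a b : R) :
  (forall x, 0 < x < l -> W x T = W x 0) -> 0 < a < b -> b < l ->
  sine_moment W a b T = sine_moment W a b 0.
Proof.
  intros Hper Ha Hb. apply RInt_ext. intros x Hx.
  rewrite Rmin_left, Rmax_right in Hx by lra.
  now rewrite Hper by lra.
Qed.

Lemma RInt_plus_scaled (f g : R -> R) (c T : R) :
  (forall t, continuous f t) -> (forall t, continuous g t) ->
  RInt (fun t => f t + c * g t) 0 T = RInt f 0 T + c * RInt g 0 T.
Proof.
  intros Hf Hg.
  assert (ex : forall h : R -> R, (forall t, continuous h t) -> ex_RInt h 0 T).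
  { intros h Hh. apply (ex_RInt_continuous (V := R_CompleteNormedModule)).
    intros; apply Hh. }
  rewrite (RInt_plus (V := R_CompleteNormedModule) f (fun t => c * g t)).
  - now rewrite (RInt_scal (V := R_CompleteNormedModule) g) by now apply ex.
  - now apply ex.
  - apply (ex_RInt_scal (V := R_NormedModule)). now apply ex.
Qed.

Lemma continuous_plus_scaled (f g : R -> R) (c t : R) :
  continuous f t -> continuous g t -> continuous (fun s => f s + c * g s) t.
Proof.
  intros Hf Hg. apply (continuous_plus (V := R_NormedModule)); [exact Hf|].
  now apply (continuous_scal_r (V := R_NormedModule) c g).
Qed.

(** * Bounds on the coefficients of a periodic differential inequality *)

(** The boundary values of [W] enter with a favourable sign and are dropped; the
    inequality for [e <= x <= l - e] holds with [PI / (l - 2 e)] and passes to the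
    limit [e -> 0]. *)
Lemma supersolution_bound (l T : R) (kap lo : R -> R)
  (W Wt Wx Wxx : R -> R -> R) :
  0 < l -> 0 < T ->
  (forall t, 0 <= kap t) ->
  (forall t, continuous kap t) -> (forall t, continuous lo t) ->
  positive_C21 l W Wt Wx Wxx ->
  (forall x, 0 < x < l -> W x T = W x 0) ->
  (forall x t, 0 < x < l -> lo t * W x t + kap t * Wxx x t <= Wt x t) ->
  RInt lo 0 T <= (PI / l) ^ 2 * RInt kap 0 T.
Proof.
  intros Hl HT Hkap0 Hkap Hlo HW Hper Hsup.
  set (H := RInt lo 0 T). set (K := RInt kap 0 T).
  assert (step : forall e, 0 < e < l / 2 -> H <= (PI / (l - 2 * e)) ^ 2 * K).
  { intros e He. set (k := PI / (l - 2 * e)).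
    assert (Ek : PI / (l - e - e) = k) by (unfold k; f_equal; ring).
    destruct (mean_log_derivative T (sine_moment W e (l - e))
                (sine_moment Wt e (l - e)) (fun t => lo t + - k ^ 2 * kap t))
      as [c [_ Hc]].
    - exact HT.
    - intros t. apply (sine_moment_pos l W Wt Wx Wxx); [assumption|lra..].
    - intros t. apply (is_derive_sine_moment l W Wt Wx Wxx); [assumption|lra..].
    - intros t. now apply continuous_plus_scaled.
    - apply (sine_moment_periodic l); [assumption|lra..].
    - rewrite RInt_plus_scaled in Hc by assumption. fold H K in Hc.
      set (J := sine_moment W e (l - e) c) in Hc.
      set (J' := sine_moment Wt e (l - e) c) in Hc.
      assert (HJ : 0 < J) by (apply (sine_moment_pos l W Wt Wx Wxx); [assumption|lra..]).
      assert (G : (lo c - kap c * k ^ 2) * J + kap c * k * (W e c + W (l - e) c) <= J').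
      { rewrite <- Ek.
        apply (sine_moment_growth_ge l _ _ W Wt Wx Wxx); [assumption|lra|lra|].
        intros x Hx. now apply Hsup. }
      assert (P : 0 <= kap c * k * (W e c + W (l - e) c)).
      { apply Rmult_le_pos; [apply Rmult_le_pos; [apply Hkap0|]|].
        - apply Rlt_le, Rdiv_lt_0_compat; [apply PI_RGT_0|lra].
        - pose proof (pc_pos _ _ _ _ _ HW e c). pose proof (pc_pos _ _ _ _ _ HW (l - e) c).
          lra. }
      assert (Q : J' / J * J = J') by (field; lra).
      assert (lo c + - k ^ 2 * kap c - J' / J <= 0).
      { apply Rnot_lt_le. intros N. nra. }
      nra. }
  apply Rnot_lt_le. intros N.
  assert (C : continuous (fun e => (PI / (l - 2 * e)) ^ 2 * K) 0).
  { apply (ex_derive_continuous (K := R_AbsRing) (V := R_NormedModule)).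
    auto_derive. lra. }
  assert (C0 : (PI / (l - 2 * 0)) ^ 2 * K < H)
    by (replace (l - 2 * 0) with l by ring; exact N).
  destruct (C (fun y => y < H) (open_lt _ _ C0)) as [d Hd].
  - pose proof (cond_pos d).
    set (e := Rmin (d / 2) (l / 4)).
    assert (0 < e /\ e <= d / 2 /\ e <= l / 4).
    { unfold e. split; [apply Rmin_pos; lra|]. split; [apply Rmin_l|apply Rmin_r]. }
    assert (B : ball 0 d e).
    { change (Rabs (e - 0) < d). rewrite Rabs_right; lra. }
    pose proof (Hd e B). pose proof (step e). lra.
Qed.

(** Continuity on the closed strip is one-sided at [x = 0] and [x = l].  Composing
    with the projection of the line onto [0, l] extends [W] continuously to the
    plane, and uniform continuity on [0, l] x [0, T] then carries the boundary
    value [0] inwards, uniformly in [t]. *)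
Lemma lateral_decay (l T : R) (W : R -> R -> R) (delta : R) :
  0 < l -> 0 < T -> 0 < delta ->
  continuous_on (fun p : R * R => 0 <= fst p <= l)
    (fun p : R * R => W (fst p) (snd p)) ->
  (forall t, W 0 t = 0 /\ W l t = 0) ->
  exists e, 0 < e <= l / 4 /\
    forall t, 0 <= t <= T -> W e t <= delta /\ W (l - e) t <= delta.
Proof.
  intros Hl HT Hdelta HW H0.
  set (cl := fun x => Rmax 0 (Rmin x l)).
  assert (cl_in : forall x, 0 <= cl x <= l).
  { intros x. unfold cl, Rmax, Rmin. repeat destruct Rle_dec; lra. }
  assert (cl_id : forall x, 0 <= x <= l -> cl x = x).
  { intros x Hx. unfold cl, Rmax, Rmin. repeat destruct Rle_dec; lra. }
  assert (cl_lip : forall x y, Rabs (cl x - cl y) <= Rabs (x - y)).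
  { intros x y. unfold cl, Rmax, Rmin, Rabs.
    repeat destruct Rle_dec; repeat destruct Rcase_abs; lra. }
  assert (C : forall x t, continuity_2d_pt (fun u v => W (cl u) v) x t).
  { intros x t eps.
    destruct (HW (cl x, t) (cl_in x) (ball (W (cl x) t) eps) (locally_ball _ eps))
      as [d Hd].
    exists d. intros u v Hu Hv.
    apply (Hd (cl u, v)); [|apply cl_in].
    split; simpl.
    - change (Rabs (cl u - cl x) < d). eapply Rle_lt_trans; [apply cl_lip|exact Hu].
    - exact Hv. }
  destruct (uniform_continuity_2d (fun u v => W (cl u) v) 0 l 0 T
              (fun x t _ _ => C x t) (mkposreal delta Hdelta)) as [d Hd].
  pose proof (cond_pos d). simpl in Hd.
  set (e := Rmin (d / 2) (l / 4)).
  assert (He : 0 < e /\ e <= d / 2 /\ e <= l / 4).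
  { unfold e. split; [apply Rmin_pos; lra|]. split; [apply Rmin_l|apply Rmin_r]. }
  exists e. split; [lra|]. intros t Ht.
  assert (Et : Rabs (t - t) < d) by (rewrite Rminus_diag, Rabs_R0; lra).
  destruct (H0 t) as [W0 Wl].
  split.
  - assert (B := Hd 0 t e t). rewrite !cl_id, W0 in B by lra.
    assert (Rabs (W e t - 0) < delta).
    { apply B; try lra. rewrite Rabs_right; lra. }
    pose proof (Rle_abs (W e t - 0)). lra.
  - assert (B := Hd l t (l - e) t). rewrite !cl_id, Wl in B by lra.
    assert (Rabs (W (l - e) t - 0) < delta).
    { apply B; try lra. rewrite Rabs_left; lra. }
    pose proof (Rle_abs (W (l - e) t - 0)). lra.
Qed.

(** A lower bound for the moment that does not degenerate as [e -> 0]: for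
    [0 < e <= l / 4] the fitted sine is at least [1 / 2] on the middle third. *)
Lemma sine_moment_lower_bound (l : R) (W Wt Wx Wxx : R -> R -> R) (e t : R) :
  positive_C21 l W Wt Wx Wxx -> 0 < e <= l / 4 ->
  RInt (fun x => W x t) (l / 3) (2 * l / 3) <= 2 * sine_moment W e (l - e) t.
Proof.
  intros HW He.
  set (s := fun x => sin (PI / (l - e - e) * (x - e))).
  assert (C : forall x, 0 < x < l -> continuous (fun y => W y t * s y) x).
  { intros x Hx. apply (continuous_arch_product (fun y => W y t)).
    now apply (pc_slice l W Wt Wx Wxx). }
  assert (ex : forall a b, 0 < a -> a <= b -> b < l ->
             ex_RInt (fun x => W x t * s x) a b).
  { intros a b Ha Hab Hb. apply ex_RInt_cont; [lra|]. intros x Hx. apply C; lra. }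
  assert (nn : forall a b, e <= a -> a <= b -> b <= l - e ->
             0 <= RInt (fun x => W x t * s x) a b).
  { intros a b Ha Hab Hb. apply RInt_ge_0; [lra| |].
    - apply ex; lra.
    - intros x Hx. apply Rmult_le_pos.
      + apply Rlt_le, (pc_pos _ _ _ _ _ HW); lra.
      + apply Rlt_le, sine_arch_pos; lra. }
  assert (M : RInt (fun x => W x t) (l / 3) (2 * l / 3)
              <= RInt (fun x => scal 2 (W x t * s x)) (l / 3) (2 * l / 3)).
  { apply RInt_le; [lra| | |].
    - apply ex_RInt_cont; [lra|]. intros x Hx.
      apply (pc_slice l W Wt Wx Wxx); [assumption|lra].
    - apply (ex_RInt_scal (V := R_NormedModule)), ex; lra.
    - intros x Hx. unfold scal; simpl; unfold mult; simpl.
      assert (/ 2 <= s x) by (apply sine_arch_ge_half; lra).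
      assert (0 < W x t) by (apply (pc_pos _ _ _ _ _ HW); lra).
      nra. }
  rewrite (RInt_scal (V := R_CompleteNormedModule)) in M by (apply ex; lra).
  unfold scal in M; simpl in M; unfold mult in M; simpl in M.
  unfold sine_moment. fold (s : R -> R).
  change (RInt (fun x => W x t) (l / 3) (2 * l / 3)
          <= 2 * RInt (fun x => W x t * s x) e (l - e)).
  assert (E1 := RInt_Chasles (V := R_CompleteNormedModule) (fun x => W x t * s x)
                  e (l / 3) (l - e) (ex e (l / 3) ltac:(lra) ltac:(lra) ltac:(lra))
                  (ex (l / 3) (l - e) ltac:(lra) ltac:(lra) ltac:(lra))).
  assert (E2 := RInt_Chasles (V := R_CompleteNormedModule) (fun x => W x t * s x)
                  (l / 3) (2 * l / 3) (l - e)
                  (ex (l / 3) (2 * l / 3) ltac:(lra) ltac:(lra) ltac:(lra))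
                  (ex (2 * l / 3) (l - e) ltac:(lra) ltac:(lra) ltac:(lra))).
  unfold plus in E1, E2; simpl in E1, E2.
  pose proof (nn e (l / 3) ltac:(lra) ltac:(lra) ltac:(lra)).
  pose proof (nn (2 * l / 3) (l - e) ltac:(lra) ltac:(lra) ltac:(lra)).
  lra.
Qed.

(** The boundary values of [W] now have the wrong sign.  Each is at most
    [delta], hence at most [delta] times [2 I / J0], where [I] is the moment and
    [J0 t] is the integral of [W] over the middle third, independent of [e].  This
    adds [delta * 8 (PI / l) kap / J0] to the growth rate, and [delta] is
    arbitrary. *)
Lemma subsolution_bound (l T : R) (kap hi : R -> R)
  (W Wt Wx Wxx : R -> R -> R) :
  0 < l -> 0 < T ->
  (forall t, 0 <= kap t) ->
  (forall t, continuous kap t) -> (forall t, continuous hi t) ->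
  positive_C21 l W Wt Wx Wxx ->
  (forall t, W 0 t = 0 /\ W l t = 0) ->
  (forall x, 0 < x < l -> W x T = W x 0) ->
  (forall x t, 0 < x < l -> Wt x t <= hi t * W x t + kap t * Wxx x t) ->
  (PI / l) ^ 2 * RInt kap 0 T <= RInt hi 0 T.
Proof.
  intros Hl HT Hkap0 Hkap Hhi HW HW0 Hper Hsub.
  pose proof PI_RGT_0 as Hpi.
  set (k0 := PI / l).
  assert (Hk0 : 0 < k0) by (apply Rdiv_lt_0_compat; lra).
  set (J0 := fun t => RInt (fun x => W x t) (l / 3) (2 * l / 3)).
  assert (HJ0 : forall t, 0 < J0 t).
  { intros t. apply RInt_gt_0; [lra| |]; intros x Hx.
    - apply (pc_pos _ _ _ _ _ HW); lra.
    - apply (pc_slice l W Wt Wx Wxx); [assumption|lra]. }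
  assert (CJ0 : forall t, continuous J0 t).
  { intros t.
    apply (continuous_ext (fun s => RInt (fun x => W x s * 1) (l / 3) (2 * l / 3))).
    - intros s. apply RInt_ext. intros; apply Rmult_1_r.
    - eapply continuous_of_derive, (is_derive_moment l W Wt Wx Wxx (fun _ => 1));
        [assumption|lra|lra|].
      intros x. apply continuous_const. }
  set (R0 := fun t => kap t * / J0 t).
  assert (CR0 : forall t, continuous R0 t).
  { intros t. apply (continuous_mult (K := R_AbsRing)); [apply Hkap|].
    apply continuous_comp; [apply CJ0|].
    apply continuity_pt_filterlim, derivable_continuous_pt.
    apply derivable_pt_inv; [specialize (HJ0 t); lra|apply derivable_pt_id]. }
  set (H := RInt hi 0 T). set (K := RInt kap 0 T). set (M := RInt R0 0 T).
  assert (step : forall delta, 0 < delta -> 0 <= H - k0 ^ 2 * K + delta * (8 * k0) * M).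
  { intros delta Hdelta.
    destruct (lateral_decay l T W delta) as [e [He Hsmall]]; try assumption.
    { apply (pc_cont _ _ _ _ _ HW). }
    set (k := PI / (l - e - e)).
    assert (Hk : k * (l - e - e) = k0 * l) by (unfold k, k0; field; lra).
    assert (Hkk : k0 <= k <= 2 * k0) by (split; nra).
    (* [k <= 2 k0] and [kap k (W e + W (l - e)) <= kap (2 k0) (2 delta)]; the factor
       [2 I / J0 >= 1] doubles this once more, whence the constant [8 k0]. *)
    destruct (mean_log_derivative T (sine_moment W e (l - e))
                (sine_moment Wt e (l - e))
                (fun t => (hi t + - k0 ^ 2 * kap t) + delta * (8 * k0) * R0 t))
      as [c [Hc01 Hc]].
    - exact HT.
    - intros t. apply (sine_moment_pos l W Wt Wx Wxx); [assumption|lra..].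
    - intros t. apply (is_derive_sine_moment l W Wt Wx Wxx); [assumption|lra..].
    - intros t. apply continuous_plus_scaled; [now apply continuous_plus_scaled|apply CR0].
    - apply (sine_moment_periodic l); [assumption|lra..].
    - rewrite (RInt_plus_scaled (fun t => hi t + - k0 ^ 2 * kap t)) in Hc;
        [|intros t; now apply continuous_plus_scaled|exact CR0].
      rewrite RInt_plus_scaled in Hc by assumption. fold H K M in Hc.
      pose proof (sine_moment_lower_bound l W Wt Wx Wxx e c HW He) as Hlow.
      set (J := sine_moment W e (l - e) c) in *.
      set (J' := sine_moment Wt e (l - e) c) in *.
      fold (J0 c) in Hlow.
      assert (HJ : 0 < J) by (apply (sine_moment_pos l W Wt Wx Wxx); [assumption|lra..]).
      assert (G : J' <= (hi c - kap c * k ^ 2) * J + kap c * k * (W e c + W (l - e) c)).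
      { apply (sine_moment_growth_le l _ _ W Wt Wx Wxx); [assumption|lra|lra|].
        intros x Hx. now apply Hsub. }
      destruct (Hsmall c Hc01) as [S1 S2].
      specialize (Hkap0 c). specialize (HJ0 c).
      assert (I1 : 1 <= 2 * J * / J0 c).
      { apply (Rmult_le_reg_r (J0 c)); [lra|].
        rewrite Rmult_assoc, Rinv_l by lra. lra. }
      assert (G1 : kap c * k * (W e c + W (l - e) c) <= kap c * (2 * k0) * (2 * delta)).
      { assert (0 < W e c) by (apply (pc_pos _ _ _ _ _ HW); lra).
        assert (0 < W (l - e) c) by (apply (pc_pos _ _ _ _ _ HW); lra).
        apply Rmult_le_compat; [apply Rmult_le_pos; lra|lra| |lra].
        apply Rmult_le_compat_l; lra. }
      assert (G2 : kap c * (2 * k0) * (2 * delta)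
                   <= kap c * (2 * k0) * (2 * delta) * (2 * J * / J0 c)).
      { rewrite <- (Rmult_1_r (kap c * (2 * k0) * (2 * delta))) at 1.
        apply Rmult_le_compat_l; [|exact I1].
        apply Rmult_le_pos; [apply Rmult_le_pos|]; lra. }
      assert (G3 : kap c * k0 ^ 2 <= kap c * k ^ 2).
      { apply Rmult_le_compat_l; [lra|]. apply pow_incr. lra. }
      assert (Q : J' / J * J = J') by (field; lra).
      set (g := hi c + - k0 ^ 2 * kap c + delta * (8 * k0) * R0 c) in Hc.
      assert (G4 : J' <= g * J).
      { apply Rle_trans with ((hi c - kap c * k0 ^ 2) * J
            + kap c * (2 * k0) * (2 * delta) * (2 * J * / J0 c)).
        - nra.
        - unfold g, R0. right. ring. }
      assert (0 <= g - J' / J).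
      { apply Rnot_lt_le. intros N. nra. }
      nra. }
  apply Rnot_lt_le. intros N.
  set (gap := k0 ^ 2 * K - H) in *.
  assert (Hgap : 0 < gap) by (unfold gap; lra).
  assert (HM : 0 <= M).
  { apply RInt_ge_0; [lra| |].
    - apply ex_RInt_cont; [lra|]. intros; apply CR0.
    - intros t _. apply Rmult_le_pos; [apply Hkap0|].
      apply Rlt_le, Rinv_0_lt_compat, HJ0. }
  (* The added [1] keeps [Z] positive even when [M = 0]. *)
  set (Z := 8 * k0 * M + 1).
  assert (HZ : 0 < Z) by (unfold Z; nra).
  assert (Hd : 0 < gap / (2 * Z)) by (apply Rdiv_lt_0_compat; lra).
  pose proof (step _ Hd) as S.
  assert (E : gap / (2 * Z) * (8 * k0) * M = gap / (2 * Z) * (Z - 1)) by (unfold Z; ring).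
  assert (E2 : gap / (2 * Z) * Z = gap / 2) by (field; lra).
  unfold gap in *. nra.
Qed.
(** * Regularity of the coefficients *)

(** The exponent is [k + beta] with [beta < 1], so exceeding [2] forces [2 <= k]. *)
Lemma of_class_C2 (alpha : R) (f : R -> R) :
  0 < alpha -> of_class (2 + alpha) f ->
  (forall t, is_derive f t (Derive f t)) /\
  (forall t, is_derive (Derive f) t (Derive_n f 2 t)) /\
  (forall t, continuous (Derive_n f 2) t).
Proof.
  intros Ha (k & beta & C & Hs & Hb & Hd & Hc & _).
  assert (Hk : (2 <= k)%nat).
  { apply (INR_lt 1 k). simpl. lra. }
  assert (D1 : forall t, ex_derive f t) by (intros t; apply (Hd 1%nat t); lia).
  assert (D2 : forall t, ex_derive (Derive f) t) by (intros t; apply (Hd 2%nat t); lia).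
  split; [|split].
  - intros t. apply Derive_correct, D1.
  - intros t. apply Derive_correct, D2.
  - intros t. destruct (Nat.eq_dec k 2) as [->|Hk2].
    + apply Hc.
    + apply (ex_derive_continuous (K := R_AbsRing) (V := R_NormedModule)).
      apply (Hd 3%nat t). lia.
Qed.

Lemma Derive_periodic (T : R) (f : R -> R) (t : R) :
  periodic T f -> (forall s, ex_derive f s) -> Derive f (t + T) = Derive f t.
Proof.
  intros Hper Hf. symmetry. apply is_derive_unique.
  apply (is_derive_ext (fun s => f (s + T))); [exact Hper|].
  evar_last.
  - apply (is_derive_comp f (fun s => s + T)).
    + apply Derive_correct, Hf.
    + apply (is_derive_plus (K := R_AbsRing) (V := R_NormedModule)).
      * apply is_derive_id. * apply is_derive_const.
  - unfold scal, plus, one, zero; simpl; unfold mult; simpl. ring.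
Qed.

(** On [0, 1] both [eta^2] and [eta] are at most [1], so the maximum moves by at
    most the sum of the changes of the two coefficients. *)
Lemma continuous_max_quadratic (a b m : R -> R) (t : R) :
  continuous a t -> continuous b t ->
  (forall s, is_max_on 0 1 (fun eta => eta ^ 2 * a s + eta * b s) (m s)) ->
  continuous m t.
Proof.
  intros Ca Cb Hm.
  assert (Lip : forall s r, m s - m r <= Rabs (a s - a r) + Rabs (b s - b r)).
  { intros s r. destruct (Hm s) as [[eta [Heta <-]] _].
    destruct (Hm r) as [_ Hr]. specialize (Hr eta Heta).
    pose proof (Rle_abs (a s - a r)). pose proof (Rle_abs (b s - b r)).
    pose proof (Rabs_pos (a s - a r)). pose proof (Rabs_pos (b s - b r)).
    assert (0 <= eta ^ 2 <= 1) by nra.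
    assert (eta ^ 2 * (a s - a r) <= Rabs (a s - a r)) by nra.
    assert (eta * (b s - b r) <= Rabs (b s - b r)) by nra.
    lra. }
  apply filterlim_locally. intros eps.
  pose proof (proj1 (filterlim_locally _ _) Ca (pos_div_2 eps)) as Ca'.
  pose proof (proj1 (filterlim_locally _ _) Cb (pos_div_2 eps)) as Cb'.
  generalize (filter_and _ _ Ca' Cb'). apply filter_imp. intros s [Ba Bb].
  change (Rabs (a s - a t) < eps / 2) in Ba.
  change (Rabs (b s - b t) < eps / 2) in Bb.
  change (Rabs (m s - m t) < eps).
  pose proof (Lip s t) as L1. pose proof (Lip t s) as L2.
  rewrite (Rabs_minus_sym (a t)), (Rabs_minus_sym (b t)) in L2.
  apply Rabs_lt_between. lra.
Qed.

Lemma Derive_n_2_unfold (f : R -> R) : Derive_n f 2 = Derive (Derive f).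
Proof. reflexivity. Qed.

(** * Removing the drift *)

(** The first two summands are a primitive in [xi] of the drift divided by twice
    the diffusion coefficient; the last cancels a term [L' / (2 L)] in the
    equation. *)
Definition gauge (D L0 : R) (A L : R -> R) (xi t : R) : R :=
  Derive A t * L t * (xi / L0) / (2 * D)
  + L t * Derive L t * (xi / L0) ^ 2 / (4 * D) + ln (L t) / 2.

Definition gauge_x (D L0 : R) (A L : R -> R) (xi t : R) : R :=
  L t * (Derive A t + xi / L0 * Derive L t) / (2 * D * L0).

Definition gauge_xx (D L0 : R) (L : R -> R) (t : R) : R :=
  L t * Derive L t / (2 * D * L0 ^ 2).

Definition gauge_t (D L0 : R) (A L : R -> R) (xi t : R) : R :=
  (Derive_n A 2 t * L t + Derive A t * Derive L t) * (xi / L0) / (2 * D)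
  + (Derive L t ^ 2 + L t * Derive_n L 2 t) * (xi / L0) ^ 2 / (4 * D)
  + Derive L t / (2 * L t).

Lemma is_derive_gauge_x (D L0 : R) (A L : R -> R) (xi t : R) :
  0 < D -> 0 < L0 ->
  is_derive (fun y => gauge D L0 A L y t) xi (gauge_x D L0 A L xi t).
Proof.
  intros HD HL0. unfold gauge, gauge_x. auto_derive; [exact I|]. field. lra.
Qed.

Lemma is_derive_gauge_xx (D L0 : R) (A L : R -> R) (xi t : R) :
  0 < D -> 0 < L0 ->
  is_derive (fun y => gauge_x D L0 A L y t) xi (gauge_xx D L0 L t).
Proof.
  intros HD HL0. unfold gauge_x, gauge_xx. auto_derive; [exact I|]. field. lra.
Qed.

Lemma is_derive_gauge_t (D L0 : R) (A L : R -> R) (xi t : R) :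
  0 < D -> 0 < L0 -> 0 < L t ->
  ex_derive L t -> ex_derive (Derive L) t -> ex_derive (Derive A) t ->
  is_derive (fun s => gauge D L0 A L xi s) t (gauge_t D L0 A L xi t).
Proof.
  intros HD HL0 HL H1 H2 H3. unfold gauge, gauge_t.
  auto_derive.
  - repeat split; assumption.
  - rewrite !Derive_n_2_unfold.
    change (Derive (fun x => L x) t) with (Derive L t).
    change (Derive (fun x => Derive L x) t) with (Derive (Derive L) t).
    change (Derive (fun x => Derive A x) t) with (Derive (Derive A) t).
    field. lra.
Qed.

Lemma continuity_2d_quadratic (p q r : R -> R) (x t : R) :
  continuous p t -> continuous q t -> continuous r t ->
  continuity_2d_pt (fun u v => u * p v + u ^ 2 * q v + r v) x t.
Proof.
  intros Hp Hq Hr.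
  apply continuity_2d_pt_plus; [apply continuity_2d_pt_plus|].
  - apply continuity_2d_pt_mult; [apply continuity_2d_pt_id1|now apply continuous_2d_snd].
  - apply continuity_2d_pt_mult; [|now apply continuous_2d_snd].
    apply (continuity_2d_pt_ext (fun u _ => u * u)); [intros; ring|].
    apply continuity_2d_pt_mult; apply continuity_2d_pt_id1.
  - now apply continuous_2d_snd.
Qed.

Lemma continuous_times (f g : R -> R) (t : R) :
  continuous f t -> continuous g t -> continuous (fun s => f s * g s) t.
Proof. apply (continuous_mult (K := R_AbsRing)). Qed.

Lemma continuous_scaled (c : R) (f : R -> R) (t : R) :
  continuous f t -> continuous (fun s => c * f s) t.
Proof. apply (continuous_scal_r (V := R_NormedModule)). Qed.

Lemma continuous_ln_comp (f : R -> R) (t : R) :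
  0 < f t -> continuous f t -> continuous (fun s => ln (f s)) t.
Proof.
  intros Hpos Hf. apply continuous_comp; [exact Hf|].
  eapply continuous_of_derive, is_derive_Reals, derivable_pt_lim_ln, Hpos.
Qed.

Lemma continuous_inv_comp (f : R -> R) (t : R) :
  0 < f t -> continuous f t -> continuous (fun s => / f s) t.
Proof.
  intros Hpos Hf. apply continuous_comp; [exact Hf|].
  apply (ex_derive_continuous (K := R_AbsRing) (V := R_NormedModule)).
  auto_derive. lra.
Qed.

Lemma continuous_gauge (D L0 : R) (A L : R -> R) (xi t : R) :
  0 < D -> 0 < L0 -> 0 < L t ->
  continuous L t -> continuous (Derive L) t -> continuous (Derive A) t ->
  continuity_2d_pt (gauge D L0 A L) xi t.
Proof.
  intros HD HL0 HL C0 C1 C2.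
  apply (continuity_2d_pt_ext
    (fun u v => u * (/ (2 * D * L0) * (Derive A v * L v))
                + u ^ 2 * (/ (4 * D * L0 ^ 2) * (L v * Derive L v))
                + / 2 * ln (L v))).
  - intros u v. unfold gauge. field. lra.
  - apply continuity_2d_quadratic; apply continuous_scaled.
    + now apply continuous_times.
    + now apply continuous_times.
    + now apply continuous_ln_comp.
Qed.

Lemma continuous_gauge_t (D L0 : R) (A L : R -> R) (xi t : R) :
  0 < D -> 0 < L0 -> (forall s, 0 < L s) ->
  continuous L t -> continuous (Derive L) t -> continuous (Derive A) t ->
  continuous (Derive_n L 2) t -> continuous (Derive_n A 2) t ->
  continuity_2d_pt (gauge_t D L0 A L) xi t.
Proof.
  intros HD HL0 HL C0 C1 C2 C3 C4.
  apply (continuity_2d_pt_ext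
    (fun u v => u * (/ (2 * D * L0) * (Derive_n A 2 v * L v + 1 * (Derive A v * Derive L v)))
                + u ^ 2 * (/ (4 * D * L0 ^ 2)
                           * (Derive L v * Derive L v + 1 * (L v * Derive_n L 2 v)))
                + / 2 * (Derive L v * / L v))).
  - intros u v. unfold gauge_t. pose proof (HL v). field. lra.
  - apply continuity_2d_quadratic; apply continuous_scaled.
    + apply continuous_plus_scaled; now apply continuous_times.
    + apply continuous_plus_scaled; now apply continuous_times.
    + apply continuous_times; [assumption|]. now apply continuous_inv_comp.
Qed.

Lemma continuity_2d_exp (f : R -> R -> R) (x t : R) :
  continuity_2d_pt f x t -> continuity_2d_pt (fun u v => exp (f u v)) x t.
Proof.
  apply (continuity_1d_2d_pt_comp exp).
  apply derivable_continuous_pt, derivable_pt_exp.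
Qed.

Lemma is_derive_gauged (f g : R -> R) (x f' g' : R) :
  is_derive f x f' -> is_derive g x g' ->
  is_derive (fun y => f y * exp (g y)) x ((f' + g' * f x) * exp (g x)).
Proof.
  intros Hf Hg. evar_last.
  - apply (is_derive_mult (K := R_AbsRing) f (fun y => exp (g y))).
    + exact Hf.
    + apply (is_derive_comp exp g); [apply is_derive_exp|exact Hg].
    + intros; apply Rmult_comm.
  - unfold plus, mult, scal; simpl; unfold mult; simpl. ring.
Qed.

(** The explicit derivatives of the gauged eigenfunction, each with the common
    factor [exp G]. *)
Lemma gauged_positive_C21 (D L0 : R) (A L : R -> R) (phi : R -> R -> R) :
  0 < D -> 0 < L0 -> (forall t, 0 < L t) ->
  (forall t, is_derive L t (Derive L t)) ->
  (forall t, is_derive (Derive L) t (Derive_n L 2 t)) ->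
  (forall t, is_derive (Derive A) t (Derive_n A 2 t)) ->
  (forall t, continuous (Derive_n L 2) t) ->
  (forall t, continuous (Derive_n A 2) t) ->
  classical_on_strip L0 phi ->
  (forall xi t, 0 < xi < L0 -> 0 < phi xi t) ->
  let G := gauge D L0 A L in
  let Gx := gauge_x D L0 A L in
  let Gxx := gauge_xx D L0 L in
  let Gt := gauge_t D L0 A L in
  positive_C21 L0
    (fun xi t => phi xi t * exp (G xi t))
    (fun xi t => (Dt phi xi t + Gt xi t * phi xi t) * exp (G xi t))
    (fun xi t => (Dxi phi xi t + Gx xi t * phi xi t) * exp (G xi t))
    (fun xi t => (Dxixi phi xi t + 2 * Gx xi t * Dxi phi xi t
                  + (Gxx t + Gx xi t ^ 2) * phi xi t) * exp (G xi t)).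
Proof.
  intros HD HL0 HL L1 L2 A2 CL2 CA2 [Hcont Hreg] Hpos G Gx Gxx Gt.
  assert (CL : forall t, continuous L t) by (intros t; eapply continuous_of_derive, L1).
  assert (CL1 : forall t, continuous (Derive L) t)
    by (intros t; eapply continuous_of_derive, L2).
  assert (CA1 : forall t, continuous (Derive A) t)
    by (intros t; eapply continuous_of_derive, A2).
  assert (DGx : forall xi t, is_derive (fun y => G y t) xi (Gx xi t))
    by (intros; now apply is_derive_gauge_x).
  assert (DGxx : forall xi t, is_derive (fun y => Gx y t) xi (Gxx t))
    by (intros; now apply is_derive_gauge_xx).
  assert (DGt : forall xi t, is_derive (fun s => G xi s) t (Gt xi t)).
  { intros xi t. apply is_derive_gauge_t; auto; eexists; eauto. }
  assert (Cexp : forall xi t, continuity_2d_pt (fun u v => exp (G u v)) xi t).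
  { intros xi t. apply continuity_2d_exp, continuous_gauge; auto. }
  assert (Cphi : forall xi t, 0 < xi < L0 -> continuity_2d_pt phi xi t).
  { intros xi t Hxi. apply continuity_2d_pt_filterlim.
    apply (continuous_continuous_on (fun p : R * R => 0 <= fst p <= L0)
             (fun p => phi (fst p) (snd p)) (xi, t)); [|exact Hcont].
    assert (Hd : 0 < Rmin xi (L0 - xi)) by (apply Rmin_pos; lra).
    exists (mkposreal _ Hd). intros [u v] [Hu _]. simpl in *.
    change (Rabs (u - xi) < Rmin xi (L0 - xi)) in Hu.
    apply Rabs_lt_between in Hu.
    pose proof (Rmin_l xi (L0 - xi)). pose proof (Rmin_r xi (L0 - xi)). lra. }
  split.
  - intros xi t Hxi. apply Rmult_lt_0_compat; [now apply Hpos|apply exp_pos].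
  - intros [xi t] Hxi. simpl.
    eapply (filterlim_comp_2 (fun p : R * R => phi (fst p) (snd p))
              (fun p : R * R => exp (G (fst p) (snd p))) Rmult).
    + apply (Hcont (xi, t) Hxi).
    + apply (filterlim_filter_le_1 (F := locally (xi, t))).
      * apply filter_le_within.
      * apply (proj1 (continuity_2d_pt_filterlim (fun u v => exp (G u v)) xi t)), Cexp.
    + apply (filterlim_mult (K := R_AbsRing)).
  - intros xi t Hxi.
    apply (is_derive_gauged (fun s => phi xi s) (fun s => G xi s)); [|apply DGt].
    apply Derive_correct, (Hreg xi t Hxi).
  - intros xi t Hxi.
    apply (is_derive_gauged (fun y => phi y t) (fun y => G y t)); [|apply DGx].
    apply Derive_correct, (Hreg xi t Hxi).
  - intros xi t Hxi. destruct (Hreg xi t Hxi) as (_ & Dx & Dxx & _).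
    apply Derive_correct in Dx. apply Derive_correct in Dxx.
    evar_last.
    + apply (is_derive_gauged (fun y => Dxi phi y t + Gx y t * phi y t) (fun y => G y t));
        [|apply DGx].
      apply (is_derive_plus (K := R_AbsRing) (V := R_NormedModule)); [exact Dxx|].
      apply (is_derive_mult (K := R_AbsRing) (fun y => Gx y t) (fun y => phi y t)).
      * apply DGxx. * exact Dx. * intros; apply Rmult_comm.
    + unfold plus, mult, Dxixi; simpl. fold (Dxi (Dxi phi) xi t). fold (Dxi phi xi t). ring.
  - intros xi t Hxi. destruct (Hreg xi t Hxi) as (_ & _ & _ & Ct & _).
    apply continuity_2d_pt_mult; [|apply Cexp].
    apply continuity_2d_pt_plus.
    + now apply continuity_2d_pt_filterlim.
    + apply continuity_2d_pt_mult; [|now apply Cphi].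
      apply continuous_gauge_t; auto.
  - intros xi t Hxi. destruct (Hreg xi t Hxi) as (_ & _ & _ & _ & Cx & Cxx).
    assert (cx : continuous (fun y => Dxi phi y t) xi)
      by now apply continuity_2d_slice, continuity_2d_pt_filterlim.
    assert (cxx : continuous (fun y => Dxixi phi y t) xi)
      by now apply continuity_2d_slice, continuity_2d_pt_filterlim.
    assert (c0 : continuous (fun y => phi y t) xi)
      by now apply continuity_2d_slice, Cphi.
    assert (cG : continuous (fun y => exp (G y t)) xi)
      by apply (continuity_2d_slice (fun u v => exp (G u v))), Cexp.
    assert (cGx : continuous (fun y => Gx y t) xi)
      by (eapply continuous_of_derive, DGxx).
    apply continuous_times; [|exact cG].
    apply (continuous_ext (fun y => (Dxixi phi y t + 2 * (Gx y t * Dxi phi y t))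
             + 1 * ((Gxx t + 1 * (Gx y t * Gx y t)) * phi y t))).
    { intros y. simpl. ring. }
    apply continuous_plus_scaled; [apply continuous_plus_scaled|]; [exact cxx|now apply continuous_times|].
    apply continuous_times; [|exact c0].
    apply continuous_plus_scaled; [apply continuous_const|now apply continuous_times].
Qed.

(** With the factor [exp G] divided out, the left side is the time derivative of
    the gauged function and the last bracket its second space derivative: the
    choice of the gauge cancels every multiple of [Dxi phi], and the terms in
    [A' L'] and [L'^2] coming from [gauge_t] cancel against the square of the
    drift, so that only [Q] and [A'^2] remain. *)
Lemma gauged_equation (D L0 mu : R) (A L : R -> R) (phi : R -> R -> R) (xi t : R) :
  0 < D -> 0 < L0 -> 0 < L t ->
  interval_operator D L0 A L phi xi t = mu * phi xi t ->
  let Gx := gauge_x D L0 A L xi t in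
  Dt phi xi t + gauge_t D L0 A L xi t * phi xi t
  = (mu - Derive A t ^ 2 / (4 * D) + Qfun A L t (xi / L0) / (2 * D)) * phi xi t
    + D * L0 ^ 2 / L t ^ 2
      * (Dxixi phi xi t + 2 * Gx * Dxi phi xi t
         + (gauge_xx D L0 L t + Gx ^ 2) * phi xi t).
Proof.
  intros HD HL0 HL E Gx. unfold interval_operator in E.
  assert (Et : Dt phi xi t = mu * phi xi t + D * (L0 ^ 2 / L t ^ 2) * Dxixi phi xi t
     + (Derive A t * L0 + xi * Derive L t) / L t * Dxi phi xi t) by lra.
  rewrite Et. unfold Gx, gauge_x, gauge_xx, gauge_t, Qfun. field. lra.
Qed.

Lemma gauge_periodic (D L0 T : R) (A L : R -> R) (xi : R) :
  L T = L 0 -> Derive L T = Derive L 0 -> Derive A T = Derive A 0 ->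
  gauge D L0 A L xi T = gauge D L0 A L xi 0.
Proof. intros E1 E2 E3. unfold gauge. now rewrite E1, E2, E3. Qed.

Theorem theorem4 (D T L0 alpha : R) (L A : R -> R) (mu : R)
  (Qover Qunder : R -> R)
  (hD : 0 < D) (hT : 0 < T) (hL0 : 0 < L0) (halpha : 0 < alpha)
  (hLpos : forall t, 0 < L t)
  (hLper : periodic T L) (hAper : periodic T A)
  (hLreg : of_class (2 + alpha) L) (hAreg : of_class (2 + alpha) A)
  (hmu : is_principal_periodic_eigenvalue L0 T (interval_operator D L0 A L) mu)
  (hQover : forall t, is_max_on 0 1 (Qfun A L t) (Qover t))
  (hQunder : forall t, is_min_on 0 1 (Qfun A L t) (- Qunder t)) :
  1 / T * RInt (fun t => D * PI ^ 2 / L t ^ 2 + Derive A t ^ 2 / (4 * D)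
                         - Qover t / (2 * D)) 0 T <= mu /\
  mu <= 1 / T * RInt (fun t => D * PI ^ 2 / L t ^ 2 + Derive A t ^ 2 / (4 * D)
                               + Qunder t / (2 * D)) 0 T.
Proof.
  destruct (of_class_C2 alpha L halpha hLreg) as (L1 & L2 & CL2).
  destruct (of_class_C2 alpha A halpha hAreg) as (A1 & A2 & CA2).
  destruct hmu as (phi & Hstrip & Heq & Hbd & Hpos & Hper).
  assert (CL : forall t, continuous L t) by (intros t; eapply continuous_of_derive, L1).
  assert (CA1 : forall t, continuous (Derive A) t)
    by (intros t; eapply continuous_of_derive, A2).
  assert (CQover : forall t, continuous Qover t).
  { intros t. apply (continuous_max_quadratic (fun s => / 2 * (Derive_n L 2 s * L s))
      (fun s => Derive_n A 2 s * L s)).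
    - apply continuous_scaled. now apply continuous_times.
    - now apply continuous_times.
    - intros s. destruct (hQover s) as [[eta [Heta E]] Hmax]. split.
      + exists eta. split; [exact Heta|]. rewrite <- E. unfold Qfun. field.
      + intros x Hx. specialize (Hmax x Hx). unfold Qfun in Hmax. lra. }
  assert (CQunder : forall t, continuous Qunder t).
  { intros t. apply (continuous_max_quadratic (fun s => - / 2 * (Derive_n L 2 s * L s))
      (fun s => -1 * (Derive_n A 2 s * L s))).
    - apply continuous_scaled. now apply continuous_times.
    - apply continuous_scaled. now apply continuous_times.
    (* [Qunder] is the maximum of [- Q]. *)
    - intros s. destruct (hQunder s) as [[eta [Heta E]] Hmin]. split.
      + exists eta. split; [exact Heta|]. unfold Qfun in E. lra.
      + intros x Hx. specialize (Hmin x Hx). unfold Qfun in Hmin. lra. }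
  set (kap := fun t => D * L0 ^ 2 * / (L t * L t)).
  assert (Hkap : forall t, 0 <= kap t).
  { intros t. specialize (hLpos t). unfold kap.
    apply Rmult_le_pos; [|apply Rlt_le, Rinv_0_lt_compat]; nra. }
  assert (Ckap : forall t, continuous kap t).
  { intros t. apply continuous_scaled, continuous_inv_comp.
    - specialize (hLpos t). nra.
    - now apply continuous_times. }
  set (bound := fun q t => (mu + - / (4 * D) * (Derive A t * Derive A t)) + / (2 * D) * q t).
  assert (Cbound : forall q : R -> R, (forall t, continuous q t) ->
            forall t, continuous (bound q) t).
  { intros q Cq t. apply continuous_plus_scaled; [|apply Cq].
    apply continuous_plus_scaled; [apply continuous_const|now apply continuous_times]. }
  pose proof (gauged_positive_C21 D L0 A L phi hD hL0 hLpos L1 L2 A2 CL2 CA2 Hstrip Hpos)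
    as HW.
  cbv zeta in HW.
  assert (Wper : forall xi, 0 < xi < L0 ->
     phi xi T * exp (gauge D L0 A L xi T) = phi xi 0 * exp (gauge D L0 A L xi 0)).
  { intros xi Hxi. rewrite gauge_periodic.
    - rewrite (Hper xi 0), Rplus_0_l by lra. reflexivity.
    - rewrite <- (hLper 0). f_equal; ring.
    - rewrite <- (Derive_periodic T L 0), Rplus_0_l; auto. intros s; eexists; apply L1.
    - rewrite <- (Derive_periodic T A 0), Rplus_0_l; auto. intros s; eexists; apply A1. }
  assert (convert : forall (q : R -> R), (forall t, continuous q t) ->
    RInt (bound q) 0 T - (PI / L0) ^ 2 * RInt kap 0 T
    = T * mu - RInt (fun t => D * PI ^ 2 / L t ^ 2 + Derive A t ^ 2 / (4 * D)
                              - q t / (2 * D)) 0 T).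
  { intros q Cq.
    assert (E1 := RInt_plus_scaled (bound q) kap (- (PI / L0) ^ 2) T (Cbound q Cq) Ckap).
    assert (E2 := RInt_plus_scaled (fun _ => mu)
       (fun t => bound q t + - (PI / L0) ^ 2 * kap t) (-1) T
       (fun t => continuous_const mu t)
       (fun t => continuous_plus_scaled _ _ _ _ (Cbound q Cq t) (Ckap t))).
    rewrite E1, RInt_const in E2.
    change (scal (T - 0) mu) with ((T - 0) * mu) in E2.
    rewrite <- (RInt_ext (fun t => mu + -1 * (bound q t + - (PI / L0) ^ 2 * kap t))
                 (fun t => D * PI ^ 2 / L t ^ 2 + Derive A t ^ 2 / (4 * D)
                           - q t / (2 * D))).
    - rewrite E2. ring.
    - intros t _. unfold bound, kap. pose proof (hLpos t).
      match goal with |- ?u = ?v => change (@eq R u v) end. field. lra. }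
  assert (Hpde : forall xi t, 0 < xi < L0 ->
    (Dt phi xi t + gauge_t D L0 A L xi t * phi xi t) * exp (gauge D L0 A L xi t)
    = bound (fun s => Qfun A L s (xi / L0)) t
        * (phi xi t * exp (gauge D L0 A L xi t))
      + kap t * ((Dxixi phi xi t + 2 * gauge_x D L0 A L xi t * Dxi phi xi t
                  + (gauge_xx D L0 L t + gauge_x D L0 A L xi t ^ 2) * phi xi t)
                 * exp (gauge D L0 A L xi t))).
  { intros xi t Hxi.
    rewrite (gauged_equation D L0 mu A L phi xi t hD hL0 (hLpos t) (Heq xi t Hxi)).
    unfold bound, kap. pose proof (hLpos t). field. lra. }
  assert (Heta : forall xi, 0 < xi < L0 -> 0 <= xi / L0 <= 1).
  { intros xi Hxi. assert (E : xi / L0 * L0 = xi) by (field; lra). nra. }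
  assert (Hbound : forall (q1 q2 : R -> R) xi t, 0 < xi < L0 -> q1 t <= q2 t ->
    bound q1 t * (phi xi t * exp (gauge D L0 A L xi t))
    <= bound q2 t * (phi xi t * exp (gauge D L0 A L xi t))).
  { intros q1 q2 xi t Hxi Hq. apply Rmult_le_compat_r.
    - apply Rlt_le, Rmult_lt_0_compat; [now apply Hpos|apply exp_pos].
    - apply Rplus_le_compat_l, Rmult_le_compat_l; [|exact Hq].
      apply Rlt_le, Rinv_0_lt_compat. lra. }
  assert (ET : 1 / T * (T * mu) = mu) by (field; lra).
  assert (HT' : 0 < 1 / T) by (apply Rdiv_lt_0_compat; lra).
  split.
  - assert (I : (PI / L0) ^ 2 * RInt kap 0 T <= RInt (bound Qover) 0 T).
    { apply (subsolution_bound L0 T kap (bound Qover) _ _ _ _ hL0 hT Hkap Ckap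
               (Cbound _ CQover) HW).
      - intros t. destruct (Hbd t) as [-> ->]. split; ring.
      - exact Wper.
      - intros xi t Hxi. rewrite (Hpde xi t Hxi).
        apply Rplus_le_compat_r, Hbound; [exact Hxi|].
        apply (hQover t), Heta, Hxi. }
    specialize (convert Qover CQover).
    apply Rle_trans with (1 / T * (T * mu)); [|right; exact ET].
    apply Rmult_le_compat_l; lra.
  - assert (CQ' : forall t, continuous (fun s => - Qunder s) t).
    { intros t. now apply (continuous_opp (V := R_NormedModule)). }
    assert (I : RInt (bound (fun s => - Qunder s)) 0 T <= (PI / L0) ^ 2 * RInt kap 0 T).
    { apply (supersolution_bound L0 T kap _ _ _ _ _ hL0 hT Hkap Ckap
               (Cbound _ CQ') HW).
      - exact Wper.
      - intros xi t Hxi. rewrite (Hpde xi t Hxi).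
        apply Rplus_le_compat_r, Hbound; [exact Hxi|].
        apply (hQunder t), Heta, Hxi. }
    specialize (convert (fun s : R => - Qunder s) CQ').
    rewrite (RInt_ext (fun t => D * PI ^ 2 / L t ^ 2 + Derive A t ^ 2 / (4 * D)
                                - (- Qunder t) / (2 * D))
                      (fun t => D * PI ^ 2 / L t ^ 2 + Derive A t ^ 2 / (4 * D)
                                + Qunder t / (2 * D))) in convert.
    + apply Rle_trans with (1 / T * (T * mu)); [right; symmetry; exact ET|].
      apply Rmult_le_compat_l; lra.
    + intros t _.
      match goal with |- ?u = ?v => change (@eq R u v) end. unfold Rdiv. ring.
Qed.
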